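(* Let $(M^n,h)$ and $(L^k,g)$ be oriented Riemannian manifolds with $n>k$, let $\alpha\in\Omega^{n-k}(M)$, and let $u\colon M\to L$ be a smooth surjection whose restriction to $M^0=\{x\in M:du_x\ne0\}$ is a submersion. Let $f$ be a smooth positive function on $M$ and, on $M^0$, let $\tilde h=h^{(2,0)}+f^2h^{(0,2)}$ be the corresponding horizontally conformal scaling of $h$. Then the Smith submersion equations $$\alpha\wedge u^*\mathrm{vol}_L=\lambda^k\,\mathrm{vol}_M,\qquad u^*g=\lambda^2h^{(0,2)}$$ are invariant under this change of metric: on $M^0$ they hold for $h$, with $\lambda^2=\frac1k|du|^2_{h,g}$ and $\mathrm{vol}_M$ the volume form of $h$, if and only if they hold with $h$ replaced by $\tilde h$, that is, with $h^{(0,2)}$ replaced by $\tilde h^{(0,2)}$, $\lambda$ replaced by $\tilde\lambda$ where $\tilde\lambda^2=\frac1k|du|^2_{\tilde h,g}$, and $\mathrm{vol}_M$ replaced by the volume form of $\tilde h$.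
   Context: On $M^0$ the tangent bundle splits $h$-orthogonally as $\ker du\oplus(\ker du)^\perp$ (vertical and horizontal subbundles), and $h=h^{(2,0)}+h^{(0,2)}$, where $h^{(2,0)}$ is the restriction of $h$ to $\ker du$ and $h^{(0,2)}$ its restriction to $(\ker du)^\perp$, each extended by zero on the complementary subbundle. The splitting is also $\tilde h$-orthogonal, and $\tilde h^{(0,2)}=f^2h^{(0,2)}$. $|du|^2_{h,g}=\operatorname{tr}_h(u^*g)$. *)

(* Defs.v *)
From HB Require Import structures.
From mathcomp Require Import all_boot all_order all_algebra all_fingroup.
From mathcomp Require Import all_classical all_reals.
From mathcomp Require Import topology normedtype derive.

Set Implicit Arguments.
Unset Strict Implicit.
Unset Printing Implicit Defensive.
Import Order.TTheory GRing.Theory Num.Theory.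
Import numFieldTopology.Exports numFieldNormedType.Exports.

Local Open Scope classical_set_scope.
Local Open Scope ring_scope.

Section LinearAlgebra.
Variables (R : realType) (n : nat).
Implicit Types (b c : 'rV[R]_n -> 'rV[R]_n -> R).

Definition bilinear_form b :=
  (forall v, scalar (b v)) /\ (forall w, scalar (b^~ w)).

Definition inner_product b :=
  [/\ bilinear_form b, forall v w, b v w = b w v
    & forall v, v != 0 -> 0 < b v v].

Definition gram b : 'M[R]_n := \matrix_(i, j) b (delta_mx 0 i) (delta_mx 0 j).

(* tr_b c = b^{ij} c_{ij} *)
Definition form_trace b c : R := \tr (invmx (gram b) *m gram c).

Definition alternating p (w : ('I_p -> 'rV[R]_n) -> R) :=
  (forall v i, scalar (fun y => w (dfwith v i y))) /\
  (forall v i j, i != j -> v i = v j -> w v = 0).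

(* Normalised so that (dx^1 /\ ... /\ dx^n)(e_1, ..., e_n) = 1. *)
Definition wedge p q (a : ('I_p -> 'rV[R]_n) -> R)
    (b : ('I_q -> 'rV[R]_n) -> R) (v : 'I_(p + q) -> 'rV[R]_n) : R :=
  ((p`! * q`!)%:R)^-1 *
  \sum_(s : 'S_(p + q)) (-1) ^+ s
     * a (fun i => v (s (lshift q i))) * b (fun j => v (s (rshift p j))).

(* sqrt (det b_{ij}) dx^1 /\ ... /\ dx^n, with the sign o = 1 or -1 according
   to whether the standard basis is positively oriented or not; by
   volume_orthonormal it is 1 on positively oriented orthonormal bases. *)
Definition volume b (o : R) (v : 'I_n -> 'rV[R]_n) : R :=
  o * Num.sqrt (\det (gram b)) * \det (\matrix_(i < n) v i).

Variables (k : nat) (A : 'rV[R]_n -> 'rV[R]_k).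

Definition vertical : set 'rV[R]_n := [set v | A v = 0].

Definition horizontal b : set 'rV[R]_n :=
  [set v | forall w, vertical w -> b v w = 0].

(* The vertical component of v in the decomposition ker A (+) (ker A)^perp; its
   existence and uniqueness are vertical_partP and vertical_part_unique. *)
Definition vertical_part b v : 'rV[R]_n :=
  xget 0 [set a | vertical a /\ horizontal b (v - a)].

Definition horizontal_part b v : 'rV[R]_n := v - vertical_part b v.

Definition form20 b v w : R := b (vertical_part b v) (vertical_part b w).

Definition form02 b v w : R := b (horizontal_part b v) (horizontal_part b w).

Definition horizontal_scaling (c : R) b v w : R :=
  form20 b v w + c ^+ 2 * form02 b v w.

End LinearAlgebra.

Lemma inner_gram (R : realType) (n : nat) (b : 'rV[R]_n -> 'rV[R]_n -> R) :
  inner_product b -> forall v w, b v w = (v *m gram b *m w^T) 0 0.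
Proof.
move=> [[bl br] _ _] v w.
have b0r x : b x 0 = 0.
  have := bl x 1 0 0; rewrite scale1r addr0 mul1r => /eqP.
  by rewrite -[X in X == _]addr0 (inj_eq (addrI _)) eq_sym => /eqP.
have b0l y : b 0 y = 0.
  have := br y 1 0 0; rewrite scale1r addr0 mul1r => /eqP.
  by rewrite -[X in X == _]addr0 (inj_eq (addrI _)) eq_sym => /eqP.
have lD y x x' : b (x + x') y = b x y + b x' y.
  by have := br y 1 x x'; rewrite scale1r mul1r.
have rD x y y' : b x (y + y') = b x y + b x y'.
  by have := bl x 1 y y'; rewrite scale1r mul1r.
have lZ (c : R) x y : b (c *: x) y = c * b x y.
  by have := br y c x 0; rewrite !addr0 b0l addr0.
have rZ (c : R) x y : b x (c *: y) = c * b x y.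
  by have := bl x c y 0; rewrite !addr0 b0r addr0.
rewrite {1}(row_sum_delta v) (big_morph (b^~ w) (lD w) (b0l w)) -mulmxA mxE.
apply: eq_bigr => i _; rewrite lZ; congr (_ * _).
rewrite {1}(row_sum_delta w) (big_morph (b _) (rD _) (b0r _)) mxE.
by apply: eq_bigr => j _; rewrite rZ !mxE mulrC.
Qed.

Lemma horizontal_part_exists (R : realType) (n k : nat)
    (A : {linear 'rV[R]_n -> 'rV[R]_k}) (b : 'rV[R]_n -> 'rV[R]_n -> R) v :
  inner_product b -> exists a, vertical A a /\ horizontal A b (v - a).
Proof.
move=> bI; have [_ _ bpos] := bI.
pose K := row_base (kermx (lin1_mx A)); pose H := gram b.
have KA : K *m lin1_mx A = 0.
  by apply/eqP; rewrite -sub_kermx eq_row_base.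
have Kfree : row_free K by apply: row_base_free.
have vertE w : A w = 0 -> exists c, w = c *m K.
  move=> Aw; apply/submxP; rewrite eq_row_base sub_kermx; apply/eqP.
  by rewrite mul_rV_lin1.
pose G := K *m H *m K^T.
have Gu : G \in unitmx.
  rewrite -row_free_unit -kermx_eq0; apply/eqP/row_matrixP => i.
  rewrite row0; set c := row i _.
  have cG : c *m G = 0.
    by apply/eqP; rewrite -sub_kermx row_sub.
  have [cK|/bpos] := eqVneq (c *m K) 0.
    by apply: (row_free_inj Kfree); rewrite cK mul0mx.
  have e : c *m K *m H *m K^T = c *m G by rewrite !mulmxA.
  by rewrite inner_gram// trmx_mul mulmxA e cG mul0mx mxE ltxx.
exists (v *m H *m K^T *m invmx G *m K); split.
  by rewrite /vertical /= -mul_rV_lin1 -mulmxA KA mulmx0.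
move=> w /vertE[c ->]; rewrite inner_gram// -/H (trmx_mul c K).
rewrite [_ *m (K^T *m c^T)]mulmxA.
suff -> : (v - v *m H *m K^T *m invmx G *m K) *m H *m K^T = 0.
  by rewrite mul0mx mxE.
set P := v *m H *m K^T.
have -> : (v - P *m invmx G *m K) *m H *m K^T = P - P *m invmx G *m G.
  by rewrite !mulmxBl !mulmxA.
by rewrite mulmxKV// subrr.
Qed.

Lemma vertical_partP (R : realType) (n k : nat)
    (A : {linear 'rV[R]_n -> 'rV[R]_k}) (b : 'rV[R]_n -> 'rV[R]_n -> R) v :
  inner_product b ->
  vertical A (vertical_part A b v) /\ horizontal A b (horizontal_part A b v).
Proof.
move=> /(horizontal_part_exists A v)[a Pa].
exact: (@xgetPex _ 0 [set a | vertical A a /\ horizontal A b (v - a)]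
  (ex_intro _ a Pa)).
Qed.

Lemma vertical_part_unique (R : realType) (n k : nat)
    (A : {linear 'rV[R]_n -> 'rV[R]_k}) (b : 'rV[R]_n -> 'rV[R]_n -> R) v a :
  inner_product b -> vertical A a -> horizontal A b (v - a) ->
  vertical_part A b v = a.
Proof.
move=> bI va ha; have [vb hb] := vertical_partP A v bI.
have [[_ br] _ bpos] := bI.
pose d := vertical_part A b v - a.
have vd : vertical A d by rewrite /vertical /= linearB /= vb va subrr.
apply/eqP; rewrite -subr_eq0 -/d; apply/negP => /negP/bpos.
have := br d (-1) (horizontal_part A b v) (v - a); rewrite hb// ha// mulr0 addr0.
have -> : -1 *: horizontal_part A b v + (v - a) = d.
  by rewrite scaleN1r /horizontal_part opprB addrA subrK.
by move=> ->; rewrite ltxx.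
Qed.

Lemma volume_orthonormal (R : realType) (n : nat)
    (b : 'rV[R]_n -> 'rV[R]_n -> R) (o : R) (v : 'I_n -> 'rV[R]_n) :
  inner_product b -> (forall i j, b (v i) (v j) = (i == j)%:R) ->
  o = Num.sg (\det (\matrix_i v i)) -> volume b o v = 1.
Proof.
move=> bI von ->; rewrite /volume; set V := \matrix_i v i.
have e : V *m gram b *m V^T = 1%:M.
  apply/matrixP => i j; rewrite [RHS]mxE -von inner_gram//.
  rewrite -(rowK v i) -(rowK v j) -/V -row_mul !mxE.
  by apply: eq_bigr => l _; rewrite !mxE.
have := congr1 determinant e; rewrite !det_mulmx det_tr det1.
move: (\det V) (\det (gram b)) => x y xyx.
have x0 : x != 0.
  by apply: contra_eq_neq xyx => ->; rewrite mulr0 eq_sym oner_neq0.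
have -> : y = x^-1 ^+ 2.
  apply: (mulfI x0); apply: (mulIf x0).
  by rewrite xyx expr2 mulrA mulfV// mul1r mulVf.
by rewrite sqrtr_sqr mulrAC -normrEsg normfV mulfV// normr_eq0.
Qed.

Fixpoint Ck_on (R : realType) (V W : normedModType R) (r : nat) (U : set V)
    (f : V -> W) : Prop :=
  if r is r'.+1 then
    (forall p, U p -> differentiable f p) /\ forall v, Ck_on r' U ('D_v f)
  else forall p, U p -> {for p, continuous f}.

Definition smooth_on (R : realType) (V W : normedModType R) (U : set V)
  (f : V -> W) : Prop := forall r, Ck_on r U f.

Record chart (R : realType) (n : nat) (T : topologicalType) := Chart {
  dom : set T;
  coord_of :> T -> 'rV[R]_n;
  point_of : 'rV[R]_n -> T;
  dom_open : open dom;
  img_open : open (coord_of @` dom);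
  coord_ofK : forall x, dom x -> point_of (coord_of x) = x;
  coord_of_cont : forall x, dom x -> {for x, continuous coord_of};
  point_of_cont : forall y, (coord_of @` dom) y -> {for y, continuous point_of}
}.

Definition img (R : realType) (n : nat) (T : topologicalType)
  (e : chart R n T) : set 'rV[R]_n := e @` dom e.

Record manifold (R : realType) (n : nat) := Manifold {
  carrier :> topologicalType;
  manifold_hausdorff : hausdorff_space carrier;
  manifold_second_countable : @second_countable carrier;
  atlas : set (chart R n carrier);
  atlas_cover : forall x, exists2 e, atlas e & dom e x;
  atlas_smooth : forall e e', atlas e -> atlas e' ->
    smooth_on (e @` (dom e `&` dom e')) (e' \o point_of e)
}.

Definition chart_at (R : realType) (n : nat) (M : manifold R n) (x : M) :
  chart R n M := s2val (cid2 (atlas_cover x)).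

(* A tangent vector at x is represented by its components in chart_at x; its
   components in any other chart e are the image by the differential of
   e \o (chart_at x)^-1. *)
Definition tangent (R : realType) (n : nat) (M : manifold R n) (x : M) : Type :=
  'rV[R]_n.

(* The i-th coordinate vector field of the chart e at x. *)
Definition coord_vector (R : realType) (n : nat) (M : manifold R n)
    (e : chart R n M) (x : M) (i : 'I_n) : tangent x :=
  'd (chart_at x \o point_of e) (e x) (delta_mx 0 i).

Definition bilinear_field (R : realType) (n : nat) (M : manifold R n) :=
  forall x : M, tangent x -> tangent x -> R.

Record riemannian_metric (R : realType) (n : nat) (M : manifold R n) :=
  RiemannianMetric {
    metric :> bilinear_field M;
    metric_inner : forall x, inner_product (@metric x);
    metric_smooth : forall e, atlas e -> forall i j,
      smooth_on (img e) (fun y : 'rV[R]_n => let x := point_of e y in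
        @metric x (coord_vector e x i) (coord_vector e x j) : R^o)
  }.

Record diff_form (R : realType) (n : nat) (M : manifold R n) (p : nat) :=
  DiffForm {
    form :> forall x : M, ('I_p -> tangent x) -> R;
    form_alternating : forall x, alternating (@form x);
    form_smooth : forall e, atlas e -> forall i : 'I_p -> 'I_n,
      smooth_on (img e) (fun y : 'rV[R]_n => let x := point_of e y in
        @form x (fun a => coord_vector e x (i a)) : R^o)
  }.

(* orient x = 1 or -1 according to whether the coordinate basis of chart_at x is
   a positively oriented basis of the tangent space at x; orient_cont says that
   the orientation of the coordinate basis of any chart e is locally constant on
   the domain of e. *)
Record orientation (R : realType) (n : nat) (M : manifold R n) := Orientation {
  orient :> M -> R;
  orient_sign : forall x, orient x = 1 \/ orient x = -1;
  orient_cont : forall e, atlas e -> forall x, dom e x ->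
    let s y := orient y * Num.sg (\det (\matrix_(i < n) coord_vector e y i)) in
    \forall y \near x, s y = s x
}.

Definition smooth_fun (R : realType) (n : nat) (M : manifold R n)
    (f : M -> R) : Prop :=
  forall e, atlas e -> smooth_on (img e) (f \o point_of e : 'rV[R]_n -> R^o).

Definition smooth_map (R : realType) (n k : nat) (M : manifold R n)
    (L : manifold R k) (u : M -> L) : Prop :=
  continuous u /\
  forall (e : chart R n M) (e' : chart R k L), atlas e -> atlas e' ->
    smooth_on (e @` (dom e `&` u @^-1` dom e')) (e' \o u \o point_of e).

Definition differential (R : realType) (n k : nat) (M : manifold R n)
    (L : manifold R k) (u : M -> L) (x : M) : tangent x -> tangent (u x) :=
  'd (chart_at (u x) \o u \o point_of (chart_at x)) (chart_at x x).
Arguments differential {R n k M L} u x v.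

Definition volume_form (R : realType) (n : nat) (M : manifold R n)
    (o : orientation M) (b : bilinear_field M) (x : M) :
  ('I_n -> tangent x) -> R := volume (b x) (o x).
Arguments volume_form {R n M} o b x v.

Section Smith.
Variables (R : realType) (n k : nat) (ltkn : (k < n)%N).
Variables (M : manifold R n) (L : manifold R k) (u : M -> L).

Definition regular_set : set M :=
  [set x | ~ (forall v, differential u x v = 0 :> 'rV[R]_k)].

Definition submersion_on (U : set M) : Prop :=
  forall x, U x -> forall w : tangent (u x), exists v, differential u x v = w.

Definition pullback_metric (g : bilinear_field L) : bilinear_field M :=
  fun x v w => g (u x) (differential u x v) (differential u x w).
Arguments pullback_metric g x v w : clear implicits.

Definition pullback_form p (w : forall y : L, ('I_p -> tangent y) -> R) :
    forall x : M, ('I_p -> tangent x) -> R :=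
  fun x v => w (u x) (fun i => differential u x (v i)).
Arguments pullback_form {p} w x v.

Definition energy_density (h : bilinear_field M) (g : bilinear_field L)
  (x : M) : R := form_trace (h x) (pullback_metric g x).

Definition dilation (h : bilinear_field M) (g : bilinear_field L) (x : M) : R :=
  Num.sqrt (k%:R^-1 * energy_density h g x).

Definition horizontally_conformal_scaling (f : M -> R) (h : bilinear_field M) :
    bilinear_field M :=
  fun x => horizontal_scaling (differential u x) (f x) (h x).

(* dilation, volume_form and form02 are all taken with respect to the metric h
   passed as argument, form02 being relative to the h-orthogonal splitting. *)
Definition smith_submersion_at (oM : orientation M) (oL : orientation L)
    (a : diff_form M (n - k)) (g : bilinear_field L) (h : bilinear_field M)
    (x : M) : Prop :=
  (forall v : 'I_n -> tangent x,
     wedge (a x) (pullback_form (volume_form oL g) x)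
       (v \o cast_ord (subnK (ltnW ltkn)))
     = dilation h g x ^+ k * volume_form oM h x v) /\
  (forall v w : tangent x,
     pullback_metric g x v w
     = dilation h g x ^+ 2
       * form02 (differential u x) (h x) v w).

End Smith.

(* Main.v *)
Require Import Defs.
From mathcomp Require Import all_boot all_order all_algebra.
From mathcomp Require Import all_classical all_reals topology.
From mathcomp Require Import normedtype derive.
Import Order.TTheory GRing.Theory Num.Theory.
Import numFieldTopology.Exports numFieldNormedType.Exports.

Set Implicit Arguments.
Unset Strict Implicit.
Unset Printing Implicit Defensive.

Local Open Scope classical_set_scope.
Local Open Scope ring_scope.

(** The statement is pointwise. At a regular point let [A] be the matrix of
    [du], acting on row vectors, and let [Q] be the [h]-orthogonal projection
    onto [(ker du)^perp]. The scaled metric is the pullback of [h] by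
    [S = 1 + (f - 1) Q], whose determinant is [f ^ k] and which satisfies
    [S A = f A]. Hence the splitting is unchanged, [h^(0,2)] is multiplied by
    [f ^ 2], the volume form by [f ^ k] and [lambda] by [f ^ -1], so that both
    [lambda ^ k vol_M] and [lambda ^ 2 h^(0,2)] are invariant. *)

(** Sylvester's identity, from two block triangular factorisations of one matrix. It moves the
    determinant of [S] from size [n] to size [k]. *)
Lemma det_add1_mulmx (R : comNzRingType) m p (B : 'M[R]_(m, p))
    (C : 'M[R]_(p, m)) :
  \det (1%:M + B *m C) = \det (1%:M + C *m B).
Proof.
have e1 : block_mx 1%:M (- B) C 1%:M
    = block_mx 1%:M (- B) 0 1%:M *m block_mx (1%:M + B *m C) 0 C 1%:M.
  rewrite mulmx_block !mul1mx !mul0mx !mulmx1 mulNmx !add0r.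
  by rewrite addrK.
have e2 : block_mx 1%:M (- B) C 1%:M
    = block_mx 1%:M 0 C 1%:M *m block_mx 1%:M (- B) 0 (1%:M + C *m B).
  rewrite mulmx_block !mul1mx !mul0mx !mulmx1 !addr0.
  by rewrite mulmxN addrC addrK.
have := congr1 determinant e1; rewrite e2 !det_mulmx.
by rewrite !det_ublock !det_lblock !det1 !mul1r !mulr1.
Qed.

Lemma gram_mulmx (R : realType) (n : nat) (b : 'rV[R]_n -> 'rV[R]_n -> R)
    (K : 'M[R]_n) :
  (forall v w, b v w = (v *m K *m w^T) 0 0) -> gram b = K.
Proof.
move=> bK; apply/matrixP => i j; rewrite mxE bK -rowE mxE.
rewrite (bigD1 j)//= big1 ?addr0 => [|l lj]; first by rewrite !mxE !eqxx mulr1.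
by rewrite !mxE (negPf lj) andbF mulr0.
Qed.

(** By positivity: a row [v] with [v *m gram b = 0] has [b v v = 0]. *)
Lemma gram_unitmx (R : realType) (n : nat) (b : 'rV[R]_n -> 'rV[R]_n -> R) :
  inner_product b -> gram b \in unitmx.
Proof.
move=> bI; have [_ _ bpos] := bI.
rewrite -row_free_unit -kermx_eq0; apply/eqP/row_matrixP => i.
rewrite row0; set v := row i _.
have vH : v *m gram b = 0 by apply/eqP; rewrite -sub_kermx row_sub.
apply: contrapT => /eqP/bpos.
by rewrite inner_gram// vH mul0mx mxE ltxx.
Qed.

Lemma gram_trmx (R : realType) (n : nat) (b : 'rV[R]_n -> 'rV[R]_n -> R) :
  inner_product b -> (gram b)^T = gram b.
Proof. by move=> [_ bC _]; apply/matrixP => i j; rewrite !mxE bC. Qed.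

Lemma inner_product_mulmx (R : realType) (n : nat)
    (b : 'rV[R]_n -> 'rV[R]_n -> R) (S : 'M[R]_n) :
  inner_product b -> S \in unitmx ->
  inner_product (fun v w => b (v *m S) (w *m S)).
Proof.
move=> [[bl br] bC bpos] Su; split=> [|v w|v v0]; last first.
- apply: bpos; apply: contra_neq v0 => /(congr1 (mulmx^~ (invmx S))).
  by rewrite mulmxK// mul0mx.
- exact: bC.
by split=> v a x y; rewrite mulmxDl -scalemxAl ?bl ?br.
Qed.

Section HorizontalScaling.
Variables (R : realType) (n k : nat) (A : {linear 'rV[R]_n -> 'rV[R]_k}).
Variables (b : 'rV[R]_n -> 'rV[R]_n -> R) (c : R).
Hypotheses (bI : inner_product b) (A_surj : forall w, exists v, A v = w).
Hypothesis (c_gt0 : 0 < c).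

Let Am := lin1_mx A.
Let H := gram b.
(** The dual metric [invmx H] evaluated on the pullbacks by [A] of the coordinate covectors. *)
Let G := Am^T *m invmx H *m Am.
(* The matrix of the horizontal lift, the right inverse of [A] with values in
   [(ker A)^perp]. *)
Let C := invmx G *m Am^T *m invmx H.
Let Q := Am *m C.
Let S := 1%:M + (c - 1) *: Q.
Let b' := horizontal_scaling A c b.

Let Hu : H \in unitmx. Proof. exact: gram_unitmx. Qed.

Let invHT : (invmx H)^T = invmx H.
Proof. by rewrite trmx_inv gram_trmx. Qed.

Let Am_full : row_full Am.
Proof.
rewrite -sub1mx; apply/row_subP => i; have [v Av] := A_surj (row i 1%:M).
by rewrite -Av -mul_rV_lin1 submxMl.
Qed.

Let Gu : G \in unitmx.
Proof.
have [_ _ bpos] := bI.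
rewrite -row_free_unit -kermx_eq0; apply/eqP/row_matrixP => i.
rewrite row0; set y := row i _.
have yG : y *m G = 0 by apply/eqP; rewrite -sub_kermx row_sub.
(* [x] is the [b]-gradient of the covector [y] composed with [A]; its squared norm is
   [y *m G *m y^T], which vanishes. *)
pose x := y *m Am^T *m invmx H.
have x0 : x = 0.
  apply: contrapT => /eqP/bpos.
  rewrite inner_gram// -/H mulmxKV// /x !trmx_mul trmxK invHT.
  have -> : y *m Am^T *m (invmx H *m (Am *m y^T)) = y *m G *m y^T.
    by rewrite !mulmxA.
  by rewrite yG mul0mx mxE ltxx.
have yA : y *m Am^T = 0 by rewrite -[LHS](mulmxKV Hu) -/x x0 mul0mx.
have AmF : row_free Am^T by rewrite /row_free mxrank_tr.
by apply: (row_free_inj AmF); rewrite yA mul0mx.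
Qed.

Let CAm : C *m Am = 1%:M.
Proof. by rewrite /C -!mulmxA (mulmxA Am^T) -/G mulVmx. Qed.

Let QAm : Q *m Am = Am. Proof. by rewrite /Q -mulmxA CAm mulmx1. Qed.

Let QQ : Q *m Q = Q. Proof. by rewrite {2}/Q mulmxA QAm. Qed.

Let SAm : S *m Am = c *: Am.
Proof.
by rewrite /S mulmxDl mul1mx -scalemxAl QAm -{1}[Am]scale1r -scalerDl subrKC.
Qed.

Let QS : Q *m S = c *: Q.
Proof.
by rewrite /S mulmxDr mulmx1 -scalemxAr QQ -{1}[Q]scale1r -scalerDl subrKC.
Qed.

(** Swapping the factors of [Q] turns it into [C *m Am = 1%:M], which leaves the scalar matrix [c]
    of size [k]. *)
Let det_S : \det S = c ^+ k.
Proof.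
rewrite /S /Q scalemxAl det_add1_mulmx -scalemxAr CAm scalemx1 -raddfD /=.
by rewrite subrKC det_scalar.
Qed.

Let Su : S \in unitmx.
Proof. by rewrite unitmxE det_S unitfE expf_neq0// gt_eqF. Qed.

(** In [Q *m H] the factor [invmx H] of [C] cancels, so the pairing with [w] ends in [Am^T *m w^T],
    the transpose of [A w]. *)
Let b_Q_vertical v w : vertical A w -> b (v *m Q) w = 0.
Proof.
move=> Aw; rewrite inner_gram// -/H /Q /C !mulmxA mulmxKV//.
rewrite -(mulmxA _ Am^T) -trmx_mul (mul_rV_lin1 A w) Aw.
by rewrite trmx0 mulmx0 mxE.
Qed.

Let vertical_sub v : vertical A (v - v *m Q).
Proof.
by rewrite /vertical /= -mul_rV_lin1 mulmxBl -mulmxA QAm subrr.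
Qed.

Let vertical_partE v : vertical_part A b v = v - v *m Q.
Proof.
apply: vertical_part_unique => // w Aw.
by rewrite subKr b_Q_vertical.
Qed.

Let horizontal_partE v : horizontal_part A b v = v *m Q.
Proof. by rewrite /horizontal_part vertical_partE subKr. Qed.

(** [S] multiplies the horizontal part by [c] and fixes the vertical part; the cross terms vanish by
    orthogonality. *)
Lemma horizontal_scalingE v w : b' v w = b (v *m S) (w *m S).
Proof.
have [[bl br] bC _] := bI.
have mulS x : x *m S = c *: (x *m Q) + (x - x *m Q).
  by rewrite /S mulmxDr mulmx1 -scalemxAr scalerBl scale1r addrCA.
rewrite /b' /horizontal_scaling /form20 /form02 !vertical_partE.
rewrite !horizontal_partE !mulS br !bl (b_Q_vertical _ (vertical_sub _)).
rewrite [b (_ - _) (_ *m _)]bC (b_Q_vertical _ (vertical_sub _)).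
by rewrite mulr0 add0r addr0 mulrA -expr2 addrC.
Qed.

Lemma inner_product_horizontal_scaling : inner_product b'.
Proof.
have -> : b' = fun v w => b (v *m S) (w *m S).
  by apply/funext => v; apply/funext => w; exact: horizontal_scalingE.
exact: inner_product_mulmx.
Qed.

Let gram_scaling : gram b' = S *m H *m S^T.
Proof.
apply: gram_mulmx => v w; rewrite horizontal_scalingE inner_gram// trmx_mul.
by rewrite !mulmxA.
Qed.

(** [S] fixes a vertical [w] and [Q *m S = c *: Q], so [b'] and [b] pair [v *m Q] with [w] up to the
    factor [c]: the orthogonal complement of the kernel is the same. *)
Let horizontal_part_scaling v : horizontal_part A b' v = v *m Q.
Proof.
rewrite /horizontal_part (@vertical_part_unique _ _ _ A b' v (v - v *m Q)) //.
- by rewrite subKr.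
- exact: inner_product_horizontal_scaling.
move=> w Aw; rewrite subKr horizontal_scalingE -mulmxA QS -scalemxAr.
have -> : w *m S = w.
  rewrite /S mulmxDr mulmx1 -scalemxAr /Q mulmxA (mul_rV_lin1 A w) Aw.
  by rewrite mul0mx scaler0 addr0.
by rewrite scalemxAl b_Q_vertical.
Qed.

Lemma form02_horizontal_scaling v w :
  form02 A b' v w = c ^+ 2 * form02 A b v w.
Proof.
rewrite /form02 !horizontal_part_scaling !horizontal_partE.
rewrite horizontal_scalingE -(mulmxA v Q) -(mulmxA w Q) QS.
rewrite -!scalemxAr !inner_gram//.
by rewrite linearZ /= -!scalemxAl -scalemxAr scalerA mxE expr2.
Qed.

Lemma volume_horizontal_scaling (o : R) v :
  volume b' o v = c ^+ k * volume b o v.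
Proof.
rewrite /volume gram_scaling !det_mulmx det_tr det_S.
(* The radicand is [(c ^+ k) ^+ 2 * \det (gram b)], and [c > 0] lets [c ^+ k] come out without
   absolute value. *)
rewrite [X in Num.sqrt X]mulrAC -expr2.
rewrite sqrtrM ?sqr_ge0// sqrtr_sqr ger0_norm ?exprn_ge0 ?ltW//.
by rewrite !mulrA (mulrC o).
Qed.

(** The inverse Gram matrix of [b'] carries one [invmx S] on each side of [invmx H]; each acts on
    [Am] as [c^-1], by [SAm]. *)
Lemma form_trace_horizontal_scaling (g : 'rV[R]_k -> 'rV[R]_k -> R) :
  inner_product g ->
  form_trace b' (fun v w => g (A v) (A w))
    = c ^- 2 * form_trace b (fun v w => g (A v) (A w)).
Proof.
move=> gI; have c0 : c != 0 by rewrite gt_eqF.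
pose X := Am *m gram g *m Am^T.
have gX : gram (fun v w => g (A v) (A w)) = X.
  apply: gram_mulmx => v w.
  by rewrite inner_gram// -!(mul_rV_lin1 A) trmx_mul !mulmxA.
have STu : S^T \in unitmx by rewrite unitmx_tr.
have iSA : invmx S *m Am = c^-1 *: Am.
  by rewrite -[in LHS](scalerK c0 Am) -SAm -scalemxAr mulKmx.
have iSX : invmx S *m X = c^-1 *: X by rewrite /X !mulmxA iSA -!scalemxAl.
have XiST : X *m invmx S^T = c^-1 *: X.
  by rewrite -mulmxA -trmx_inv -trmx_mul iSA linearZ -scalemxAr.
have igram : invmx (gram b') = invmx S^T *m invmx H *m invmx S.
  have gu : S *m H *m S^T \in unitmx by rewrite !unitmx_mul Su Hu.
  rewrite gram_scaling; apply: (can_inj (mulKmx gu)).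
  by rewrite mulmxV// !mulmxA mulmxK// mulmxK// mulmxV.
rewrite /form_trace gX igram -mulmxA iSX -scalemxAr mxtraceZ -mulmxA.
(* Cyclicity of the trace brings the remaining [invmx S^T] to the right of [X]. *)
rewrite mxtrace_mulC -mulmxA XiST -scalemxAr mxtraceZ mulrA -invfM.
by rewrite -expr2.
Qed.

End HorizontalScaling.

Theorem mainTheorem7 (R : realType) (n k : nat) (ltkn : (k < n)%N)
    (M : manifold R n) (oM : orientation M) (h : riemannian_metric M)
    (L : manifold R k) (oL : orientation L) (g : riemannian_metric L)
    (alpha : diff_form M (n - k)) (u : M -> L)
    (u_smooth : smooth_map u) (u_surj : forall y : L, exists x : M, u x = y)
    (u_subm : submersion_on u (regular_set u))
    (f : M -> R) (f_smooth : smooth_fun f) (f_pos : forall x, 0 < f x) :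
  (forall x, regular_set u x -> smith_submersion_at ltkn u oM oL alpha g h x)
  <->
  (forall x, regular_set u x ->
     smith_submersion_at ltkn u oM oL alpha g
       (horizontally_conformal_scaling u f h) x).
Proof.
suff smithE x : regular_set u x ->
    smith_submersion_at ltkn u oM oL alpha g h x
    <-> smith_submersion_at ltkn u oM oL alpha g
          (horizontally_conformal_scaling u f h) x.
  by split=> Hx x ux; apply/(smithE x ux); exact: Hx.
move=> ux; set h' := horizontally_conformal_scaling u f h.
(* This is [differential u x] with its linear structure exposed, so that the pointwise lemmas apply
   up to conversion. *)
pose A : {linear 'rV[R]_n -> 'rV[R]_k} :=
  'd (chart_at (u x) \o u \o point_of (chart_at x)) (chart_at x x).
have A_surj w : exists v, A v = w by exact: u_subm ux w.
have hI := metric_inner h x; have fx := f_pos x.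
have fx0 : f x != 0 by rewrite gt_eqF.
have dilE : dilation u h' g x = (f x)^-1 * dilation u h g x.
  rewrite /dilation /energy_density.
  have -> := form_trace_horizontal_scaling hI A_surj fx (metric_inner g (u x)).
  rewrite mulrCA sqrtrM ?invr_ge0 ?sqr_ge0//.
  by rewrite -exprVn sqrtr_sqr ger0_norm// invr_ge0 ltW.
have volE v : dilation u h' g x ^+ k * volume_form oM h' x v
    = dilation u h g x ^+ k * volume_form oM h x v.
  have e := volume_horizontal_scaling hI A_surj fx (oM x) v.
  rewrite dilE /volume_form [X in _ * X]e exprMn mulrACA -exprMn mulVf//.
  by rewrite expr1n mul1r.
have f02E v w : dilation u h' g x ^+ 2 * form02 (differential u x) (h' x) v w
    = dilation u h g x ^+ 2 * form02 (differential u x) (@metric _ _ _ h x) v w.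
  have e := form02_horizontal_scaling hI A_surj fx v w.
  by rewrite dilE [X in _ * X]e exprMn mulrACA -exprMn mulVf// expr1n mul1r.
split=> -[vol_eq met_eq]; split=> v.
- by rewrite volE.
- by move=> w; rewrite f02E.
- by rewrite -volE.
- by move=> w; rewrite -f02E.
Qed.
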